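(* Let $\{X_t\}_{t\in\mathbb Z}$ be i.i.d. real-valued random variables with distribution function $F$ which is twice differentiable with density $f=F'$ satisfying $$\sup_{x\in\mathbb R}\big(f(x)+|f'(x)|\big)<\infty\quad\text{and}\quad \mathbb P(|X_1|>x)\le Cx^{-\lambda}\ \text{for all } x>0$$ for some constant $C>0$ and fixed $\lambda>18/5$. Let $\beta\in(0,1)$ be fixed and assume $f(q_\beta)>0$, where $q_\beta=F^-(\beta)$. Then, as $n\to\infty$, $$\frac1{\sqrt n}\max_{1\le i<j\le n}(j-i+1)\Big|[\hat q_\beta]_i^j-q_\beta-\frac{\beta-\hat F_i^j(q_\beta)}{f(q_\beta)}\Big|=o_{\mathbb P}(1).$$
   Context: For a distribution function $G$, $G^-(\beta)=\inf\{x\in\mathbb R: G(x)\ge\beta\}$. $\hat F_i^j(z)=\frac1{j-i+1}\sum_{t=i}^jI\{X_t\le z\}$ is the empirical distribution function of $X_i,\dots,X_j$ and $[\hat q_\beta]_i^j=(\hat F_i^j)^-(\beta)$ the corresponding empirical $\beta$-quantile. *)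

(* Defs.v *)
From HB Require Import structures.
From mathcomp Require Import all_boot all_order all_algebra.
From mathcomp Require Import all_classical all_reals all_analysis.
Set Implicit Arguments. Unset Strict Implicit. Unset Printing Implicit Defensive.
Import Order.TTheory GRing.Theory Num.Theory.
Import numFieldNormedType.Exports.
Local Open Scope classical_set_scope.
Local Open Scope ring_scope.

Definition mutually_independent d (T : measurableType d) (R : realType)
  (P : probability T R) (X : nat -> {RV P >-> R}) : Prop :=
  forall (s : seq nat) (B : nat -> set R), uniq s ->
    (forall i, measurable (B i)) ->
    P (\bigcap_(i in [set` s]) (X i @^-1` B i)) =
    (\prod_(i <- s) P (X i @^-1` B i))%E.

Definition geninv (R : realType) (G : R -> R) (beta : R) : R :=
  inf [set x : R | beta <= G x].

Definition empF d (T : measurableType d) (R : realType) (X : nat -> T -> R)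
  (i j : nat) (w : T) (z : R) : R :=
  (j - i + 1)%:R^-1 * \sum_(i <= t < j.+1) (if X t w <= z then 1 else 0).

Definition empq d (T : measurableType d) (R : realType) (X : nat -> T -> R)
  (beta : R) (i j : nat) (w : T) : R :=
  geninv (empF X i j w) beta.

(* Main.v *)
(* Put v = n^(1/36), so that sqrt n = v^18, and let m = j - i + 1. Outside an
   event of probability o(1) all |X_t| with t <= n are at most v^10, since
   lambda > 18/5; this bounds the empirical quantile and settles the windows with
   m < v^6.

   For m >= v^6, let k be the number of observations of the window that are at
   most q, and y = q + (beta - k/m)/f(q). The empirical quantile lies within
   eps/sqrt m of y as soon as the empirical distribution function is >= beta at
   y + eps/sqrt m and < beta at y - eps/sqrt m. By Taylor's formula this holds
   when the centred empirical process varies by less than f(q) eps sqrt(m)/2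
   between q and these two points. Since k takes only m + 1 values, and
   |k - m beta| <= v sqrt m up to a negligible event, only polynomially many
   pairs of deterministic points occur; each increment is a centred binomial
   variable of success probability O(v / sqrt m), whose Chernoff bound is
   exp(- rate v^2), and the union bound concludes. *)
Require Import Defs.
From HB Require Import structures.
From mathcomp Require Import all_boot all_order all_algebra.
From mathcomp Require Import all_classical all_reals all_analysis.
From mathcomp Require Import measurable_realfun.
From mathcomp Require Import ring lra.
Import Order.TTheory GRing.Theory Num.Theory.
Import numFieldNormedType.Exports.
Local Open Scope classical_set_scope.
Local Open Scope ring_scope.

(** * Exponential moments and concentration for sums of independent indicators *)

(** Multiply by [1 - x > 0]: the left side becomes at most 1 since [1 - x <= expR (- x)], and the
    right side becomes [1 + x ^+ 2 * (1 - 2 * x) >= 1]. Negative [x] is allowed, so both tails of a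
    sum can use the bound. *)
Lemma expR_le_quadratic (R : realType) (x : R) :
  x <= 2^-1 -> expR x <= 1 + x + 2 * x ^+ 2.
Proof.
move=> x_le.
have h : (1 - x) * expR x <= 1.
  rewrite -[leRHS](expRxMexpNx_1 x) mulrC ler_pM2l ?expR_gt0//.
  exact: expR_ge1Dx.
have h2 : 1 <= (1 - x) * (1 + x + 2 * x ^+ 2).
  have -> : (1 - x) * (1 + x + 2 * x ^+ 2) = 1 + x ^+ 2 * (1 - 2 * x) by ring.
  rewrite lerDl mulr_ge0 ?sqr_ge0//; lra.
have x1 : 0 < 1 - x by lra.
by rewrite -(ler_pM2l x1) (le_trans h).
Qed.

Lemma measure_subset d (T : measurableType d) (R : realType)
    (mu : {measure set T -> \bar R}) (A B : set T) :
  measurable A -> measurable B -> A `<=` B -> (mu A <= mu B)%E.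
Proof. by move=> mA mB AB; apply: le_measure; rewrite ?inE. Qed.

Definition hits {T : Type} {R : realType} (X : nat -> T -> R) (B : set R)
  (s : seq nat) (w : T) : R := \sum_(t <- s) \1_B (X t w).

Section Concentration.
Context d (T : measurableType d) (R : realType) (P : probability T R).
Variable X : nat -> {RV P >-> R}.
Hypothesis indepX : mutually_independent X.

Lemma measurable_hits (B : set R) (s : seq nat) :
  measurable B -> measurable_fun setT (hits (fun t => X t) B s).
Proof.
move=> mB; apply: measurable_sum => t.
by apply: measurableT_comp => //; exact: measurable_indic.
Qed.

Let cyl (B : nat -> set R) (s : seq nat) : set T :=
  \bigcap_(i in [set` s]) (X i @^-1` B i).

Let mX t (B : set R) : measurable B -> measurable (X t @^-1` B).
Proof. by move=> mB; rewrite -[_ @^-1` _]setTI; exact: measurable_funP. Qed.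

Let cyl_cons (B : nat -> set R) t s :
  cyl B (t :: s) = (X t @^-1` B t) `&` cyl B s.
Proof.
apply/seteqP; split => w /=.
  move=> h; split; first by apply: h; rewrite /= mem_head.
  by move=> i /= si; apply: h; rewrite /= inE si orbT.
by move=> [h1 h2] i /=; rewrite inE => /orP[/eqP->//|si]; apply: h2.
Qed.

Let measurable_cyl B s : (forall i, measurable (B i)) -> measurable (cyl B s).
Proof.
move=> mB; elim: s => [|t s IH].
  rewrite (_ : cyl _ _ = setT)//; apply/seteqP; split=> // w _ i //.
by rewrite cyl_cons; apply: measurableI => //; exact: mX.
Qed.

(* The exponential moment of a sum of independent indicators, factored one
   variable at a time; the cylinder records the variables already split. *)
Lemma hits_chernoff_cylinder (B : set R) (p x : R) (s : seq nat) :
  measurable B -> (forall t, P (X t @^-1` B) = p%:E) ->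
  forall (s' : seq nat) (B' : nat -> set R) (a : R),
  (forall i, measurable (B' i)) -> uniq (s ++ s') ->
  (P ([set w | (a <= x * hits (fun t => X t) B s w)%R] `&` cyl B' s') <=
   (expR (- a) * (1 - p + p * expR x) ^+ size s)%:E * P (cyl B' s'))%E.
Proof.
move=> mB pB.
have p01 : 0 <= p <= 1.
  by rewrite -!lee_fin -(pB 0%N) measure_ge0 probability_le1//; exact: mX.
have mset (a : R) s1 : measurable [set w | a <= x * hits (fun t => X t) B s1 w].
  rewrite -[X in measurable X]setTI; apply: measurable_fun_le => //.
  by apply: measurable_funM => //; exact: measurable_hits.
elim: s => [|t s IH] s' B' a mB' /=.
  (* The empty sum is 0: for [a <= 0] the factor [expR (- a)] is at least 1, and for [a > 0] the
     event is empty. *)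
  move=> _; rewrite expr0 mulr1 -[leRHS]muleC.
  have mC := measurable_cyl _ s' mB'.
  have [a0|a0] := leP a 0.
    apply: (@le_trans _ _ (P (cyl B' s'))).
      by apply: le_measure; rewrite ?inE//; apply: measurableI.
    rewrite -[leLHS]mule1; apply: lee_pmul => //.
    by rewrite lee_fin -[leLHS]expR0 ler_expR oppr_ge0.
  rewrite (_ : _ `&` _ = set0) ?measure0; last first.
    apply/seteqP; split => // w [/=]; rewrite /hits big_nil mulr0 => h.
    by move: (lt_le_trans a0 h); rewrite ltxx.
  by rewrite mule_ge0// lee_fin expR_ge0.
move=> /andP[tns us].
have us' : uniq (s ++ t :: s').
  by rewrite -cat1s catA cat_uniq -cat_uniq -catA uniq_catCA /= tns us.
pose U (D : set R) (i : nat) := if i == t then D else B' i.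
have mU D : measurable D -> forall i, measurable (U D i).
  by move=> mD i; rewrite /U; case: ifP.
have cylU D : cyl (U D) (t :: s') = (X t @^-1` D) `&` cyl B' s'.
  rewrite cyl_cons /U eqxx; congr (_ `&` _).
  apply: eq_bigcapr => i /= si; case: eqP => // it.
  by move: tns; rewrite mem_cat -it si orbT.
have PU D p' : measurable D -> P (X t @^-1` D) = p'%:E ->
    P (cyl (U D) (t :: s')) = (p'%:E * P (cyl B' s'))%E.
  move=> mD pD; rewrite /cyl indepX//; last 2 first.
  - by move: us'; rewrite cat_uniq => /and3P[].
  - exact: mU.
  rewrite indepX//; last by move: us'; rewrite cat_uniq => /and3P[_ _ /andP[]].
  rewrite big_cons {1}/U eqxx pD; congr (_ * _)%E.
  rewrite big_seq [RHS]big_seq; apply: eq_bigr => i si.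
  rewrite /U; case: eqP => // it.
  by move: tns; rewrite mem_cat -it si orbT.
have pBc : P (X t @^-1` (~` B)) = (1 - p)%:E.
  by rewrite preimage_setC probability_setC ?pB//; exact: mX.
set E := _ `&` _.
(* Split on whether [X t] lies in [B]: a hit lowers the threshold for the remaining sum from [a] to
   [a - x]. *)
have sub : E `<=`
    ([set w | (a - x <= x * hits (fun t => X t) B s w)%R] `&` cyl (U B) (t :: s'))
    `|` ([set w | (a <= x * hits (fun t => X t) B s w)%R] `&` cyl (U (~` B)) (t :: s')).
  move=> w [/= h1 h2]; rewrite !cylU.
  move: h1; rewrite /hits big_cons mulrDr.
  have [Bw|Bw] := pselect (B (X t w)).
    rewrite indicE mem_set// mulr1 => h; left; split; first by rewrite /= lerBlDl.
    by split.
  rewrite indicE memNset// mulr0 add0r => h; right; split => //.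
have m1 D b : measurable D ->
    measurable ([set w | (b <= x * hits (fun t => X t) B s w)%R] `&` cyl (U D) (t :: s')).
  by move=> mD; apply: measurableI => //; apply: measurable_cyl; exact: mU.
have mBc : measurable (~` B) by exact: measurableC.
apply: le_trans (measure_subset _ _ _ P _ _ _ _ sub) _.
- by apply: measurableI => //; exact: measurable_cyl.
- by apply: measurableU; exact: m1.
apply: (le_trans (measureU2 _ (m1 _ _ mB) (m1 _ _ mBc))).
apply: (le_trans (leeD (IH _ _ _ (mU _ mB) us') (IH _ _ _ (mU _ mBc) us'))).
rewrite (PU _ p)// (PU _ (1 - p))//.
have fP : P (cyl B' s') \is a fin_num by apply: fin_num_measure; exact: measurable_cyl.
rewrite -(fineK fP) -!EFinM -EFinD lee_fin exprS.
rewrite opprB expRD le_eqVlt; apply/orP; left; apply/eqP.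
ring.
Qed.

Lemma hits_chernoff (B : set R) (p x a : R) (s : seq nat) :
  measurable B -> (forall t, P (X t @^-1` B) = p%:E) -> uniq s ->
  (P [set w | (a <= x * hits (fun t => X t) B s w)%R] <=
   (expR (- a) * (1 - p + p * expR x) ^+ size s)%:E)%E.
Proof.
move=> mB pB us.
have := @hits_chernoff_cylinder B p x s mB pB [::] (fun=> setT) a (fun=> measurableT).
rewrite cats0 => /(_ us).
rewrite (_ : cyl _ _ = setT) ?setIT ?probability_setT ?mule1//.
by apply/seteqP; split=> // w _ i.
Qed.

(** The exponential bound is used at [x = y] and [x = - y], with [1 - p + p * expR x <= expR (p * (x
    + 2 * x ^+ 2))]. The factor [p] survives in the quadratic term, which matters for increments
    over short intervals; [y] is left free for each application. *)
Lemma hits_concentration (B : set R) (p y r : R) (s : seq nat) :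
  measurable B -> (forall t, P (X t @^-1` B) = p%:E) -> uniq s ->
  0 <= y <= 2^-1 ->
  (P [set w | (r <= `|hits (fun t => X t) B s w - (size s)%:R * p|)%R] <=
   (2 * expR (2 * (size s)%:R * p * y ^+ 2 - y * r))%:E)%E.
Proof.
move=> mB pB us /andP[y0 y1].
set m : R := (size s)%:R.
have p01 : 0 <= p <= 1.
  by rewrite -!lee_fin -(pB 0%N) measure_ge0 probability_le1//; exact: mX.
have mset (x a : R) : measurable [set w | a <= x * hits (fun t => X t) B s w].
  rewrite -[X in measurable X]setTI; apply: measurable_fun_le => //.
  by apply: measurable_funM => //; exact: measurable_hits.
have tail x : x <= 2^-1 ->
    (P [set w | (x * (m * p) + y * r <= x * hits (fun t => X t) B s w)%R] <=
    (expR (2 * m * p * x ^+ 2 - y * r))%:E)%E.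
  move=> x1; apply: (le_trans (hits_chernoff _ _ _ _ _ mB pB us)).
  rewrite lee_fin.
  have -> : 2 * m * p * x ^+ 2 - y * r =
    - (x * (m * p) + y * r) + p * (x + 2 * x ^+ 2) * m by ring.
  rewrite expRD ler_pM2l ?expR_gt0// /m expRM_natr lerXn2r ?nnegrE ?expR_ge0//.
    by rewrite addr_ge0 ?mulr_ge0 ?expR_ge0//; lra.
  apply: le_trans (expR_ge1Dx _).
  have := expR_le_quadratic _ _ x1; nra.
have sub : [set w | r <= `|hits (fun t => X t) B s w - m * p|] `<=`
  [set w | y * (m * p) + y * r <= y * hits (fun t => X t) B s w] `|`
  [set w | (- y) * (m * p) + y * r <= (- y) * hits (fun t => X t) B s w].
  move=> w /=; rewrite ler_normr => /orP[h|h]; [left|right] => /=; nra.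
apply: le_trans (measure_subset _ _ _ P _ _ _ _ sub) _.
- rewrite -[X in measurable X]setTI; apply: measurable_fun_le => //.
  apply: measurableT_comp => //; apply: measurable_funB => //.
  exact: measurable_hits.
- by apply: measurableU; exact: mset.
apply: (le_trans (measureU2 _ (mset _ _) (mset _ _))).
rewrite mulr_natl mulr2n EFinD; apply: leeD; first exact: tail.
by have := tail (- y); rewrite sqrrN; apply; lra.
Qed.

End Concentration.

(** * Expansions of a function with bounded derivatives *)

(** The points [a] and [b] are not ordered and [c] is located only by its distance to [a], so one
    statement serves both sides of an expansion point. *)
Lemma mean_value (R : realType) (g : R -> R) (a b : R) :
  (forall x, derivable g x 1) ->
  exists2 c, `|c - a| <= `|b - a| & g b - g a = derive1 g c * (b - a).
Proof.
move=> dg.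
have dd (x : R) : is_derive x 1 g (derive1 g x).
  by rewrite derive1E; exact: derivableP.
have cg u v : {within `[u, v], continuous g}.
  by apply: derivable_within_continuous => x _.
have [ab|/ltW ba] := leP a b.
  have [c] := @MVT_segment R g (derive1 g) a b ab (fun x _ => dd x) (cg _ _).
  rewrite in_itv/= => /andP[ac cb] e; exists c => //.
  rewrite !ger0_norm ?subr_ge0//; lra.
have [c] := @MVT_segment R g (derive1 g) b a ba (fun x _ => dd x) (cg _ _).
rewrite in_itv/= => /andP[ac cb] e; exists c; last by lra.
rewrite !ler0_norm ?subr_le0//; lra.
Qed.

Section BoundedDerivatives.
Variables (R : realType) (F : R -> R) (M : R).
Hypothesis dF : forall x, derivable F x 1.
Hypothesis ddF : forall x, derivable (derive1 F) x 1.
Hypothesis F_bound : forall x, derive1 F x + `|derive1 (derive1 F) x| <= M.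

Lemma increment_le (a b : R) : a <= b -> F b - F a <= M * (b - a).
Proof.
move=> ab; have [c _ ->] := mean_value _ F a b dF.
apply: ler_wpM2r; first by rewrite subr_ge0.
apply: le_trans (F_bound c); by rewrite lerDl.
Qed.

Hypothesis F_nd : {homo F : x y / x <= y}.

(** The mean value theorem is applied to [F], then to its derivative, the intermediate point being
    no farther from [q] than [x] is. *)
Lemma taylor2 (q x : R) :
  `|F x - F q - derive1 F q * (x - q)| <= M * (x - q) ^+ 2.
Proof.
(* Monotonicity makes the first derivative nonnegative, so the bound on the sum controls the second
   derivative alone. *)
have derF0 c : 0 <= derive1 F c.
  rewrite derive1E; apply: limr_ge; first exact: dF.
  apply: nearW => h /=.
  rewrite /GRing.scale/= mulr1.
  have [h0|/ltW h0] := leP 0 h.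
    by rewrite mulr_ge0 ?invr_ge0// subr_ge0 F_nd// lerDr.
  by rewrite mulr_le0 ?invr_le0// subr_le0 F_nd// gerDr.
have [c cq ->] := mean_value _ F q x dF.
have [c' _ e] := mean_value _ (derive1 F) q c ddF.
rewrite -mulrBl e -mulrA !normrM -real_normK ?num_real// expr2.
have M0 : `|derive1 (derive1 F) c'| <= M.
  by apply: le_trans (F_bound c'); rewrite lerDr.
by apply: ler_pM => //; exact: ler_wpM2r.
Qed.

End BoundedDerivatives.

(** * Generalized inverse of a nondecreasing function *)

Section GeneralizedInverse.
Variables (R : realType) (G : R -> R) (beta lo hi : R).
Hypothesis G_nd : {homo G : x y / x <= y}.
Hypotheses (G_lo : G lo < beta) (G_hi : beta <= G hi).

Let E := [set x : R | beta <= G x].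

Let lbE x : G x < beta -> lbound E x.
Proof.
move=> Gx y /= Gy; rewrite leNgt; apply/negP => yx.
by have := le_lt_trans (le_trans Gy (G_nd _ _ (ltW yx))) Gx; rewrite ltxx.
Qed.

Let E_inf : has_inf E.
Proof. by split; [exists hi|exists lo; exact: lbE]. Qed.

Lemma geninv_le x : beta <= G x -> geninv G beta <= x.
Proof. by move=> Gx; apply: ge_inf => //; case: E_inf. Qed.

Lemma geninv_ge x : G x < beta -> x <= geninv G beta.
Proof. by move=> Gx; apply: lb_le_inf; [exists hi|exact: lbE]. Qed.

(** Rational witnesses turn the event that a quantile is below [x] into a countable union, which
    yields measurability of the empirical quantile. *)
Lemma geninv_lt x :
  geninv G beta < x <-> exists2 r : rat, ratr r < x & beta <= G (ratr r).
Proof.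
split=> [h|[r rx Gr]]; last exact: le_lt_trans (geninv_le _ Gr) rx.
have e0 : 0 < x - geninv G beta by rewrite subr_gt0.
have [y Gy] := inf_adherent e0 E_inf.
rewrite -/(geninv G beta) addrC subrK => yx.
have [r] := rat_in_itvoo yx.
rewrite in_itv/= => /andP[yr rx]; exists r => //.
by apply: le_trans Gy (G_nd _ _ (ltW yr)).
Qed.

(** If [G] exceeded [beta] at the infimum, continuity would give a smaller point of the set; if it
    were below [beta], continuity would give a larger lower bound. *)
Lemma geninv_eq : continuous G -> G (geninv G beta) = beta.
Proof.
move=> cG; apply/eqP; rewrite eq_le; apply/andP; split.
  rewrite leNgt; apply/negP => h.
  have : \forall x \near geninv G beta, beta < G x.
    by apply: (@cvgr_gt R R (nbhs (geninv G beta)) _ G _ (cG _)) h.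
  move=> /nbhs_ballP[e /= e0 he].
  have := he (geninv G beta - e / 2).
  rewrite /ball/= opprB addrCA subrr addr0 gtr0_norm ?divr_gt0//.
  rewrite ltr_pdivrMr// mulr_natr mulr2n ltrDl => /(_ e0) /= hb.
  have := geninv_le _ (ltW hb).
  by rewrite leNgt gtrDl oppr_lt0 divr_gt0.
rewrite leNgt; apply/negP => h.
have : \forall x \near geninv G beta, G x < beta.
    by apply: (@cvgr_lt R R (nbhs (geninv G beta)) _ G _ (cG _)) h.
  move=> /nbhs_ballP[e /= e0 he].
have := he (geninv G beta + e / 2).
rewrite /ball/= opprD addrA subrr add0r normrN gtr0_norm ?divr_gt0//.
rewrite ltr_pdivrMr// mulr_natr mulr2n ltrDl => /(_ e0) /= hb.
have := geninv_ge _ hb.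
by rewrite leNgt ltrDl divr_gt0.
Qed.

End GeneralizedInverse.

(** * Counts, empirical distribution functions and empirical quantiles *)

Section Hits.
Context {d} {T : measurableType d} {R : realType}.
Implicit Types (X : nat -> T -> R) (s : seq nat) (w : T).

Definition count_le X s w (z : R) : R := hits X `]-oo, z] s w.

(** Integrality confines the count to finitely many values, so that a random centre can be replaced
    by a union over deterministic ones. *)
Lemma count_le_nat X s w z :
  exists2 k, (k <= size s)%N & count_le X s w z = k%:R.
Proof.
rewrite /count_le /hits; elim: s => [|t s [k ks e]].
  by exists 0%N => //; rewrite big_nil.
rewrite big_cons e indicE; case: (_ \in _).
  by exists k.+1 => //; rewrite -natr1 addrC.
by exists k; [exact: ltnW|rewrite add0r].
Qed.

Lemma count_leB X s w a b : a <= b ->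
  count_le X s w b - count_le X s w a = hits X `]a, b] s w.
Proof.
move=> ab; rewrite /count_le /hits -sumrB; apply: eq_bigr => t _.
rewrite !indicE !mem_setE !in_itv/=.
by have [h1|h1] := leP (X t w) a; have [h2|h2] := leP (X t w) b;
  rewrite ?subrr ?subr0//=; lra.
Qed.

Lemma count_le_nd X s w : {homo count_le X s w : x y / x <= y}.
Proof.
move=> x y xy; rewrite -subr_ge0 count_leB// /hits sumr_ge0// => t _.
Qed.

Lemma empF_count X i j w z : (i <= j)%N ->
  empF X i j w z = (j - i + 1)%:R^-1 * count_le X (index_iota i j.+1) w z.
Proof.
move=> ij; congr (_ * _); apply: eq_bigr => t _.
by rewrite indicE mem_setE in_itv/=; case: ifP.
Qed.

Lemma size_window i j : (i <= j)%N -> size (index_iota i j.+1) = (j - i + 1)%N.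
Proof. by move=> ij; rewrite size_iota subSn// addn1. Qed.

Lemma empF_nd X i j w : (i <= j)%N -> {homo empF X i j w : x y / x <= y}.
Proof.
move=> ij x y xy; rewrite !empF_count//.
by apply: ler_wpM2l; [rewrite invr_ge0|exact: count_le_nd].
Qed.

Lemma empF_below X i j w A x :
  (forall t, (i <= t <= j)%N -> `|X t w| <= A) -> x < - A -> empF X i j w x = 0.
Proof.
move=> XA xA; rewrite /empF big1_seq ?mulr0// => t /andP[_].
rewrite mem_index_iota ltnS => /XA; rewrite ler_norml => /andP[h _].
by rewrite leNgt (lt_le_trans xA h).
Qed.

Lemma empF_above X i j w A :
  (i <= j)%N -> (forall t, (i <= t <= j)%N -> `|X t w| <= A) -> empF X i j w A = 1.
Proof.
move=> ij XA; rewrite /empF (eq_big_seq (fun=> 1)); last first.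
  move=> t; rewrite mem_index_iota ltnS => /XA; rewrite ler_norml => /andP[_ h].
  by rewrite h.
by rewrite big_const_nat iter_addr_0 subSn// addn1 mulVf.
Qed.

Lemma sample_bound X i j w :
  exists A, forall t, (i <= t <= j)%N -> `|X t w| <= A.
Proof.
exists (\sum_(i <= t < j.+1) `|X t w|) => t /andP[it tj].
rewrite (bigD1_seq t) ?iota_uniq ?mem_index_iota ?ltnS ?it//=.
by rewrite lerDl sumr_ge0.
Qed.

(** Holds at every sample point, so that the infimum defining the empirical quantile is over a
    nonempty set bounded below. *)
Lemma empF_bracket X i j w beta : (i <= j)%N -> 0 < beta < 1 ->
  exists lo hi, empF X i j w lo < beta /\ beta <= empF X i j w hi.
Proof.
move=> ij /andP[b0 b1]; have [A XA] := sample_bound X i j w.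
(* An observation may equal [- A]; the extra 1 puts the lower point strictly below the sample. *)
exists (- A - 1), A; rewrite (empF_above _ _ _ _ _ ij XA) (empF_below _ _ _ _ _ _ XA).
  by split=> //; exact: ltW.
by rewrite ltrBlDr ltrDl.
Qed.

Lemma empq_bound X i j w beta A : (i <= j)%N -> 0 < beta < 1 ->
  (forall t, (i <= t <= j)%N -> `|X t w| <= A) -> `|empq X beta i j w| <= A.
Proof.
move=> ij b01 XA; have [lo [hi [Hlo Hhi]]] := empF_bracket X i j w beta ij b01.
case/andP: b01 => b0 b1.
have nd := empF_nd X i j w ij.
rewrite ler_norml; apply/andP; split; last first.
  apply: (geninv_le _ _ _ _ _ nd Hlo Hhi).
  by rewrite (empF_above _ _ _ _ _ ij XA) ltW.
apply/ler_addgt0Pl => e e0; rewrite -lerBlDl.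
apply: (geninv_ge _ _ _ _ nd Hhi).
by rewrite (empF_below _ _ _ _ _ _ XA)// ltrBlDr ltrDl.
Qed.

Lemma empF_ge0_le1 X i j w z : (i <= j)%N -> 0 <= empF X i j w z <= 1.
Proof.
move=> ij; rewrite empF_count//.
have [k] := count_le_nat X (index_iota i j.+1) w z.
rewrite size_window// => km ->.
have m0 : 0 < (j - i + 1)%:R :> R by rewrite ltr0n addn1.
by rewrite mulr_ge0 ?invr_ge0//= ler_pdivrMl// mulr1 ler_nat.
Qed.

End Hits.

(* The quantile lies below [x] as soon as [m * beta <= S x], so it suffices to
   evaluate [S] at the two points at distance [eps / sqrt m] from the
   linearization [y]. *)
Lemma quantile_linearization (R : realType) (S F : R -> R)
    (m q f M beta v eps lo hi : R) :
  let G := fun z => m^-1 * S z in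
  let y := q + (beta - S q / m) / f in
  let h := Num.sqrt m in
  0 < m -> 0 < f -> 0 < eps -> 0 <= M -> 1 <= v -> F q = beta ->
  (forall x, `|F x - F q - f * (x - q)| <= M * (x - q) ^+ 2) ->
  {homo S : x z / x <= z} -> G lo < beta -> beta <= G hi ->
  `|S q - m * beta| <= v * h ->
  (forall x, x = y + eps / h \/ x = y - eps / h ->
     `|S x - S q - m * (F x - F q)| < f * eps * h / 2) ->
  M * ((f^-1 + eps) * v) ^+ 2 <= f * eps * h / 2 ->
  m * `|geninv G beta - q - (beta - G q) / f| <= eps * h.
Proof.
move=> G y h m0 f0 e0 M0 v1 Fq taylor Snd Glo Ghi Sq Sx hlarge.
have h0 : 0 < h by rewrite sqrtr_gt0.
have mh : m = h ^+ 2 by rewrite sqr_sqrtr// ltW.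
have Gnd : {homo G : x z / x <= z}.
  by move=> x z xz; rewrite /G ler_pM2l ?invr_gt0//; exact: Snd.
(* Here [h * |x - q| <= (f^-1 + eps) * v], from the deviation of [S q] and from the offset [eps];
   the Taylor remainder thus takes at most half of the margin [f * eps * h]. *)
have dist x : x = y + eps / h \/ x = y - eps / h ->
    m * (M * (x - q) ^+ 2) <= f * eps * h / 2.
  move=> xE; apply: le_trans hlarge.
  rewrite mulrCA ler_wpM2l// mh -exprMn -real_normK ?num_real//.
  rewrite lerXn2r ?nnegrE ?mulr_ge0 ?addr_ge0 ?invr_ge0//; try lra.
  have nq : `|h * ((beta - S q / m) / f)| <= v / f.
    rewrite mulrA normrM (gtr0_norm (x := f^-1)) ?invr_gt0//.
    rewrite ler_pM2r ?invr_gt0//.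
    rewrite -(ler_pM2l h0) -[X in X * _ <= _](gtr0_norm h0) -normrM.
    have -> : h * (h * (beta - S q / m)) = - (S q - m * beta).
      by rewrite mh; field; rewrite gt_eqF.
    by rewrite normrN [h * v]mulrC.
  have ev : eps <= eps * v by rewrite ler_peMr// ltW.
  have -> : (f^-1 + eps) * v = v / f + eps * v by ring.
  have xq : h * (x - q) = h * ((beta - S q / m) / f) + eps \/
            h * (x - q) = h * ((beta - S q / m) / f) - eps.
    by case: xE => ->; [left|right]; rewrite /y; field; rewrite !gt_eqF.
  have ee : `|eps| = eps by rewrite gtr0_norm.
  case: xq => ->.
    by apply: (le_trans (ler_normD _ _)); rewrite ee lerD.
  by apply: (le_trans (ler_normB _ _)); rewrite ee lerD.
have feh : m * (f * (eps / h)) = f * eps * h.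
  by rewrite mh; field; rewrite gt_eqF.
have lin : m * (f * ((beta - S q / m) / f)) = m * beta - S q.
  by field; rewrite !gt_eqF.
(* The other half of the margin is left to the fluctuation of [S]. *)
have key x : x = y + eps / h \/ x = y - eps / h ->
    `|S x - S q - m * (f * (x - q))| < f * eps * h.
  move=> xE; have h1 := Sx _ xE; have h2 := dist _ xE.
  have -> : S x - S q - m * (f * (x - q)) =
    (S x - S q - m * (F x - F q)) + m * (F x - F q - f * (x - q)) by ring.
  apply: (le_lt_trans (ler_normD _ _)).
  rewrite normrM (gtr0_norm m0).
  have : m * `|F x - F q - f * (x - q)| <= m * (M * (x - q) ^+ 2).
    by rewrite ler_pM2l.
  lra.
(* At [y + eps / h] the linear term is [m * beta - S q + f * eps * h], and the error is smaller than
   its last summand, so [S] exceeds [m * beta] there. The lower point is symmetric. *)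
have up : geninv G beta <= y + eps / h.
  apply: (geninv_le _ _ _ _ _ Gnd Glo Ghi); rewrite /G mulrC ler_pdivlMr// mulrC.
  have := key _ (or_introl erefl).
  rewrite (_ : m * (f * _) = m * beta - S q + f * eps * h); last first.
    by rewrite -feh -lin /y; ring.
  rewrite ltr_norml => /andP[h1 _]; lra.
have low : y - eps / h <= geninv G beta.
  apply: (geninv_ge _ _ _ _ Gnd Ghi); rewrite /G mulrC ltr_pdivrMr// [beta * m]mulrC.
  have := key _ (or_intror erefl).
  rewrite (_ : m * (f * _) = m * beta - S q - f * eps * h); last first.
    by rewrite -feh -lin /y; ring.
  rewrite ltr_norml => /andP[_ h1]; lra.
have -> : eps * h = m * (eps / h) by rewrite mh; field; rewrite gt_eqF.
rewrite ler_pM2l// ler_norml.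
have -> : (beta - G q) / f = y - q.
  by rewrite /y /G mulrC addrAC subrr add0r [m^-1 * _]mulrC mulrC.
apply/andP; split; lra.
Qed.

Lemma powRN_cvg0 (R : realType) (a : R) :
  0 < a -> (n%:R : R) `^ (- a) @[n --> \oo] --> 0.
Proof.
move=> a0; apply/cvgrPdist_le => e e0.
have /archi_boundP := powR_ge0 e^-1 a^-1.
set N := Num.bound _ => /ltW hN.
exists N.+1 => // n /= Nn; rewrite sub0r normrN ger0_norm ?powR_ge0//.
have n0 : 0 < n%:R :> R by rewrite ltr0n (leq_ltn_trans _ Nn).
rewrite powRN -[e]invrK lef_pV2 ?posrE ?invr_gt0 ?powR_gt0//.
have -> : e^-1 = (e^-1 `^ a^-1) `^ a.
  by rewrite -powRrM mulVf ?gt_eqF// powRr1// invr_ge0 ltW.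
apply: ge0_ler_powR; rewrite ?nnegrE ?powR_ge0//; try exact: ltW.
by apply: (le_trans hN); rewrite ler_nat ltnW.
Qed.

(** * Measurability of the empirical quantities *)

Section Measurability.
Context d (T : measurableType d) (R : realType).

Lemma measurable_abs_ge (r : R) (g : T -> R) :
  measurable_fun setT g -> measurable [set w | r <= `|g w|].
Proof.
move=> mg; rewrite -[X in measurable X]setTI; apply: measurable_fun_le => //.
exact: measurableT_comp.
Qed.

Lemma measurable_abs_gt (r : R) (g : T -> R) :
  measurable_fun setT g -> measurable [set w | r < `|g w|].
Proof.
move=> mg; rewrite (_ : mkset _ = ~` [set w | `|g w| <= r]); last first.
  apply/seteqP; split=> w /=; first by rewrite ltNge => /negP.
  by move=> /negP; rewrite -ltNge.
apply: measurableC; rewrite -[X in measurable X]setTI.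
by apply: measurable_fun_le => //; exact: measurableT_comp.
Qed.

Lemma measurable_bigmax (I : eqType) (r : seq I) (h : I -> T -> R) :
  (forall i, i \in r -> measurable_fun setT (h i)) ->
  measurable_fun setT (fun w => \big[Order.max/0]_(i <- r) h i w).
Proof.
elim: r => [|i r IH] mh.
  by under eq_fun do rewrite big_nil; exact: measurable_cst.
under eq_fun do rewrite big_cons; apply: measurable_maxr.
  by apply: mh; rewrite mem_head.
by apply: IH => k kr; apply: mh; rewrite inE kr orbT.
Qed.

Variable X : nat -> T -> R.
Hypothesis mX : forall t, measurable_fun setT (X t).

Lemma measurable_empF i j z : measurable_fun setT (fun w => empF X i j w z).
Proof.
apply: measurable_funM => //; apply: measurable_sum => t.
apply: measurable_fun_ifT => //.
exact: measurable_fun_ler.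
Qed.

Lemma measurable_empq beta i j : (i <= j)%N -> 0 < beta < 1 ->
  measurable_fun setT (empq X beta i j).
Proof.
move=> ij b01 _; apply: (measurability _ (RGenInftyO.measurableE R)) => //.
move=> _ [_ [x ->] <-]; rewrite setTI.
rewrite (_ : _ @^-1` _ = \bigcup_(r in [set r : rat | ratr r < x])
    [set w | beta <= empF X i j w (ratr r)]); last first.
  apply/seteqP; split=> w /=; rewrite in_itv/=;
    have [lo [hi [Hlo Hhi]]] := empF_bracket X i j w beta ij b01;
    have lt := geninv_lt _ _ _ _ _ (empF_nd X i j w ij) Hlo Hhi x.
    by move=> /lt[r rx Gr]; exists r.
  by move=> [r /= rx Gr]; apply/lt; exists r.
rewrite bigcup_mkcond; apply: bigcupT_measurable_rat => r; case: ifP => _ //.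
rewrite -[X in measurable X]setTI; apply: measurable_fun_le => //.
exact: measurable_empF.
Qed.

End Measurability.

(** * The common distribution function and its tails *)

Section Distribution.
Context d (T : measurableType d) (R : realType) (P : probability T R).
Variables (X : nat -> {RV P >-> R}) (F : R -> R).
Hypothesis cdfX : forall t x, P [set w | X t w <= x] = (F x)%:E.

Let mX t (B : set R) : measurable B -> measurable (X t @^-1` B).
Proof. by move=> mB; rewrite -[_ @^-1` _]setTI; exact: measurable_funP. Qed.

Lemma prob_le t x : P (X t @^-1` `]-oo, x]) = (F x)%:E.
Proof.
by rewrite -(cdfX t); congr (P _); apply/seteqP; split=> w /=; rewrite in_itv.
Qed.

Lemma cdf_nd : {homo F : x y / x <= y}.
Proof.
move=> x y xy; rewrite -lee_fin -!(prob_le 0); apply: measure_subset => //.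
- exact: mX.
- exact: mX.
- by move=> w /=; rewrite !in_itv/= => /le_trans; exact.
Qed.

Lemma prob_gt t x : P (X t @^-1` `]x, +oo[) = (1 - F x)%:E.
Proof.
rewrite -setCitvl -preimage_setC probability_setC ?prob_le//; exact: mX.
Qed.

Lemma prob_itv t a b : a <= b -> P (X t @^-1` `]a, b]) = (F b - F a)%:E.
Proof.
move=> ab; rewrite EFinB -!(prob_le t).
rewrite (_ : X t @^-1` `]a, b] = X t @^-1` `]-oo, b] `\` X t @^-1` `]-oo, a]).
  have fin : (P (X t @^-1` `]-oo, b]) < +oo)%E by rewrite prob_le ltry.
  rewrite measureD//; try exact: mX.
  congr (_ - P _)%E; apply/seteqP; split=> w /=; rewrite !in_itv/=.
    by move=> [].
  by move=> h; split=> //; exact: le_trans ab.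
apply/seteqP; split=> w /=; rewrite !in_itv/=.
  by move=> /andP[h ->]; split=> //; apply/negP; rewrite -ltNge.
by move=> [-> /negP]; rewrite -ltNge => ->.
Qed.

Variables (C lambda : R).
Hypothesis C0 : 0 < C.
Hypothesis tailX : forall x : R, 0 < x ->
  (P [set w | (x < `|X 1%N w|)%R] <= (C * x `^ (- lambda))%:E)%E.

(** The event [X <= - x] includes equality while the tail hypothesis is strict; halving [x] absorbs
    the difference at the price of a constant. *)
Lemma cdf_tail_left x : 0 < x -> F (- x) <= C * (x / 2) `^ (- lambda).
Proof.
move=> x0; rewrite -lee_fin -(prob_le 1).
have x2 : 0 < x / 2 by rewrite divr_gt0.
apply: le_trans (tailX _ x2).
apply: measure_subset; [exact: mX|exact: measurable_abs_gt|].
move=> w /=; rewrite in_itv/= => h.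
rewrite lt_neqAle ler_normr; apply/andP; split; last by apply/orP; right; lra.
by apply/eqP => e; move: h; have := ler_norm (- X 1%N w); rewrite normrN -e; lra.
Qed.

Lemma cdf_tail_right x : 0 < x -> 1 - F x <= C * (x / 2) `^ (- lambda).
Proof.
move=> x0; rewrite -lee_fin -(prob_gt 1).
have x2 : 0 < x / 2 by rewrite divr_gt0.
apply: le_trans (tailX _ x2).
apply: measure_subset; [exact: mX|exact: measurable_abs_gt|].
move=> w /=; rewrite in_itv/= andbT => h.
apply: lt_le_trans (ler_norm _); lra.
Qed.

(** The tail hypothesis concerns index 1; it passes to every [t] through the common distribution
    function, with one summand for each tail. *)
Lemma prob_abs_gt t x : 0 < x ->
  (P [set w | (x < `|X t w|)%R] <= (2 * (C * (x / 2) `^ (- lambda)))%:E)%E.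
Proof.
move=> x0; rewrite mulr_natl mulr2n EFinD.
apply: (@le_trans _ _ (P (X t @^-1` `]-oo, (- x)] `|` X t @^-1` `]x, +oo[))).
  apply: measure_subset => //.
  - exact: measurable_abs_gt.
  - by apply: measurableU; exact: mX.
  move=> w /=; rewrite !in_itv/= andbT ltr_normr => /orP[h|h]; [by right|left].
  by rewrite lerNr ltW.
apply: le_trans (measureU2 _ _ _) _; [exact: mX|exact: mX|].
apply: leeD.
  have := cdf_tail_left x x0; by rewrite -lee_fin -(prob_le t).
have := cdf_tail_right x x0; by rewrite -lee_fin -(prob_gt t).
Qed.

Hypothesis lambda0 : 0 < lambda.

Lemma cdf_bracket beta : 0 < beta < 1 -> exists lo hi, F lo < beta /\ beta <= F hi.
Proof.
move=> /andP[b0 b1].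
have tail0 e : 0 < e -> exists2 x : R, 0 < x & C * (x / 2) `^ (- lambda) < e.
  move=> e0.
  have /cvgrPdist_lt/(_ _ (divr_gt0 e0 C0))[N _ hN] := powRN_cvg0 _ _ lambda0.
  (* The factor 2 cancels the halving in the tail bounds. *)
  exists (2 * N.+1%:R); first by rewrite mulr_gt0.
  have := hN N.+1 (leqnSn N); rewrite sub0r normrN ger0_norm ?powR_ge0//.
  by rewrite ltr_pdivlMr// mulrC [2 * _]mulrC mulfK.
have [x x0 hx] := tail0 _ b0.
have b1' : 0 < 1 - beta by rewrite subr_gt0.
have [y y0 hy] := tail0 _ b1'.
exists (- x), y; split; first exact: le_lt_trans (cdf_tail_left _ x0) hx.
have := cdf_tail_right _ y0; lra.
Qed.

End Distribution.

Lemma prob_bigcup_le d (T : measurableType d) (R : realType) (P : probability T R)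
    (A : nat -> set T) (n : nat) (b : R) :
  (forall i, measurable (A i)) -> (forall i, (P (A i) <= b%:E)%E) ->
  (P (\bigcup_(i in `I_n) A i) <= (n%:R * b)%:E)%E.
Proof.
move=> mA PA; rewrite bigcup_mkord.
apply: (le_trans (Boole_inequality P _)) => //.
apply: (@le_trans _ _ (\sum_(i < n) b%:E)%E).
  by apply: lee_sum => i _; exact: PA.
by rewrite sumEFin lee_fin sumr_const card_ord mulr_natl.
Qed.

(** * Concentration of counts and of their increments *)

Section CountTails.
Context d (T : measurableType d) (R : realType) (P : probability T R).
Variables (X : nat -> {RV P >-> R}) (F : R -> R).
Hypothesis indepX : mutually_independent X.
Hypothesis cdfX : forall t x, P [set w | X t w <= x] = (F x)%:E.

Local Notation count := (count_le (fun t => X t)).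

Lemma measurable_count s z : measurable_fun setT (fun w => count s w z).
Proof. exact: measurable_hits. Qed.

Lemma count_tail s z y r : uniq s -> 0 <= y <= 2^-1 ->
  (P [set w | (r <= `|count s w z - (size s)%:R * F z|)%R] <=
   (2 * expR (2 * (size s)%:R * F z * y ^+ 2 - y * r))%:E)%E.
Proof.
move=> us y01; apply: hits_concentration => // t; exact: prob_le.
Qed.

(** Grid points lie on both sides of the quantile, so [x] and [z] are not ordered; [|F x - F z|] is
    the probability that one observation falls between them. *)
Lemma count_increment_tail s x z y r : uniq s -> 0 <= y <= 2^-1 ->
  (P [set w | (r <= `|count s w x - count s w z - (size s)%:R * (F x - F z)|)%R] <=
   (2 * expR (2 * (size s)%:R * `|F x - F z| * y ^+ 2 - y * r))%:E)%E.
Proof.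
move=> us y01.
have ordered a b : a <= b ->
    (P [set w | (r <= `|count s w b - count s w a - (size s)%:R * (F b - F a)|)%R] <=
   (2 * expR (2 * (size s)%:R * `|F b - F a| * y ^+ 2 - y * r))%:E)%E.
  move=> ab; under eq_set => w do rewrite count_leB//.
  rewrite [`|F b - F a|]ger0_norm ?subr_ge0; last exact: cdf_nd cdfX _ _ ab.
  by apply: hits_concentration => // t; exact: prob_itv.
have [zx|/ltW xz] := leP z x; first exact: ordered.
have := ordered _ _ xz; rewrite [`|F z - F x|]distrC.
congr (P _ <= _)%E; apply/seteqP.
split=> w /=; rewrite -normrN; congr (_ <= `|_|); ring.
Qed.

End CountTails.

(** * The exceptional event, its probability and the bound outside it *)

Section BadEvent.
Context d (T : measurableType d) (R : realType) (P : probability T R).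
Variables (X : nat -> {RV P >-> R}) (F : R -> R) (C lambda beta M eps : R).
Hypothesis indepX : mutually_independent X.
Hypothesis cdfX : forall t x, P [set w | X t w <= x] = (F x)%:E.
Hypothesis dF : forall x, derivable F x 1.
Hypothesis ddF : forall x, derivable (derive1 F) x 1.
Hypothesis F_bound : forall x, derive1 F x + `|derive1 (derive1 F) x| <= M.
Hypothesis C0 : 0 < C.
Hypothesis lambda0 : 0 < lambda.
Hypothesis tailX : forall x : R, 0 < x ->
  (P [set w | (x < `|X 1%N w|)%R] <= (C * x `^ (- lambda))%:E)%E.
Hypothesis beta01 : 0 < beta < 1.
Let q := geninv F beta.
Let f := derive1 F q.
Hypothesis f0 : 0 < f.
Hypothesis eps0 : 0 < eps.

Local Notation count := (count_le (fun t => X t)).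
Local Notation len i j := ((j - i + 1)%:R : R).

(** With [h] the square root of the window length, [K * v / h] bounds the distance from a grid point
    to [q]. The Chernoff parameter for increments is [c / v]: the first bound on [c] keeps it at
    most 1/2, the second makes the quadratic term at most half the linear one. [rate] is the smaller
    of the exponents for centres and increments. *)
Let K := f^-1 + eps.
Let c := Order.min 2^-1 (f * eps / (8 * (M * K))).
Let rate := Order.min 8^-1 (c * (f * eps) / 4).

Let M0 : 0 < M.
Proof.
apply: (lt_le_trans f0); apply: le_trans (F_bound q); by rewrite lerDl.
Qed.

Let K0 : 0 < K. Proof. by rewrite addr_gt0// invr_gt0. Qed.

Let c0 : 0 < c.
Proof. by rewrite lt_min invr_gt0 ltr0n divr_gt0// ?mulr_gt0. Qed.

Lemma rate_gt0 : 0 < rate.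
Proof. by rewrite lt_min invr_gt0 ltr0n divr_gt0// ?mulr_gt0. Qed.

Let Fq : F q = beta.
Proof.
have [lo [hi [Hlo Hhi]]] := cdf_bracket _ _ _ _ _ _ cdfX _ _ C0 tailX lambda0 _ beta01.
apply: geninv_eq Hlo Hhi _; first exact: cdf_nd cdfX.
by move=> x; apply: differentiable_continuous; apply/derivable1_diffP; exact: dF.
Qed.

(* [k] runs over the possible values of the count at [q]; this makes the random
   centre of the quantile's linearization range over a finite set. *)
Definition grid_point (i j k : nat) (sg : bool) : R :=
  q + (beta - k%:R / len i j) / f + (-1) ^+ sg * (eps / Num.sqrt (len i j)).

(** Empty for [k] far from its mean: those values belong to the centre event. For the others the
    grid point is close enough to [q] for the success probability to be small. *)
Definition increment_event (v : R) (i j k : nat) (sg : bool) : set T :=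
  if `|k%:R - len i j * beta| <= v * Num.sqrt (len i j) then
    [set w | f * eps * Num.sqrt (len i j) / 2 <=
      `|count (index_iota i j.+1) w (grid_point i j k sg)
        - count (index_iota i j.+1) w q
        - len i j * (F (grid_point i j k sg) - F q)| ]
  else set0.

Definition centre_event (v : R) (i j : nat) : set T :=
  [set w | v * Num.sqrt (len i j) <=
    `|count (index_iota i j.+1) w q - len i j * beta| ].

(** Windows shorter than [v ^+ 6] give the empty event: they are controlled by the bound [v ^+ 10]
    on the sample. *)
Definition window_event (n : nat) (v : R) (i j : nat) : set T :=
  if (i < j)%N && (v ^+ 6 <= len i j) then
    centre_event v i j `|`
    \bigcup_(k in `I_n.+1)
      (increment_event v i j k false `|` increment_event v i j k true)
  else set0.

Definition bad_event (n : nat) (v : R) : set T :=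
  \bigcup_(t in `I_n.+1) [set w | v ^+ 10 < `|X t w| ] `|`
  \bigcup_(i in `I_n.+1) \bigcup_(j in `I_n.+1) window_event n v i j.

Let measurable_increment_event v i j k sg : measurable (increment_event v i j k sg).
Proof.
rewrite /increment_event; case: ifP => // _; apply: measurable_abs_ge.
apply: measurable_funB => //; apply: measurable_funB; exact: measurable_count.
Qed.

Let measurable_centre_event v i j : measurable (centre_event v i j).
Proof.
by apply: measurable_abs_ge; apply: measurable_funB => //; exact: measurable_count.
Qed.

Let measurable_window_event n v i j : measurable (window_event n v i j).
Proof.
rewrite /window_event; case: ifP => // _; apply: measurableU => //.
by apply: bigcup_measurable => k _; exact: measurableU.
Qed.

Lemma measurable_bad_event n v : measurable (bad_event n v).
Proof.
apply: measurableU.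
  by apply: bigcup_measurable => t _; exact: measurable_abs_gt.
by apply: bigcup_measurable => i _; apply: bigcup_measurable => j _.
Qed.

Section Bounds.
Variables (v : R) (i j : nat).
Hypothesis v1 : 1 <= v.
Hypothesis ij : (i < j)%N.
Hypothesis long : v ^+ 6 <= len i j.

Let h := Num.sqrt (len i j).

Let m0 : 0 < len i j. Proof. by rewrite ltr0n addn1. Qed.

Let hE : h ^+ 2 = len i j.
Proof. by rewrite sqr_sqrtr// ltW. Qed.

Let h0 : 0 < h. Proof. by rewrite sqrtr_gt0. Qed.

Let h0w : 0 <= h. Proof. exact: ltW. Qed.

Let v0 : 0 < v. Proof. exact: lt_le_trans v1. Qed.

Let v0w : 0 <= v. Proof. exact: ltW. Qed.

Let fe0 : 0 < f * eps. Proof. exact: mulr_gt0. Qed.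

Let fe0w : 0 <= f * eps. Proof. exact: ltW. Qed.

Let c0w : 0 <= c. Proof. exact: ltW. Qed.

Lemma sqrt_len_ge : v ^+ 3 <= h.
Proof.
by rewrite -(@ler_pXn2r _ 2) ?nnegrE ?exprn_ge0// hE -exprM.
Qed.

Let v3 : v <= v ^+ 3.
Proof. by rewrite -[leLHS]expr1 ler_weXn2l. Qed.

Lemma prob_centre_event :
  (P (centre_event v i j) <= (2 * expR (- (rate * v ^+ 2)))%:E)%E.
Proof.
have vh : v <= h := le_trans v3 sqrt_len_ge.
(* This parameter gives the exponent [v ^+ 2 * (beta / 8 - 1 / 4)], at most [- v ^+ 2 / 8]. *)
have y01 : 0 <= v / (4 * h) <= 2^-1.
  rewrite divr_ge0 ?mulr_ge0//= ler_pdivrMr ?mulr_gt0//; have := h0; lra.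
have := count_tail _ _ _ _ _ _ indepX cdfX (index_iota i j.+1) q _ (v * h)
  (iota_uniq _ _) y01.
rewrite (size_window _ _ (ltnW ij)) Fq => /le_trans; apply.
rewrite lee_fin ler_pM2l// ler_expR.
have -> : 2 * len i j * beta * (v / (4 * h)) ^+ 2 - v / (4 * h) * (v * h) =
    v ^+ 2 * (beta / 8 - 1 / 4) by rewrite -hE; field; rewrite gt_eqF.
have : rate * v ^+ 2 <= 8^-1 * v ^+ 2.
  by rewrite ler_wpM2r ?sqr_ge0// ge_min lexx.
case/andP: beta01 => _ b1.
have : v ^+ 2 * beta <= v ^+ 2 by rewrite ler_piMr ?sqr_ge0// ltW.
lra.
Qed.

(** The centre contributes [v / (f * h)], as [h ^+ 2] is the window length; the offset [eps / h] is
    at most [eps * v / h] since [v >= 1]. *)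
Let grid_dist k sg : `|k%:R - len i j * beta| <= v * h ->
  `|grid_point i j k sg - q| <= K * v / h.
Proof.
move=> hk; rewrite /grid_point -/h.
have -> : q + (beta - k%:R / len i j) / f + (-1) ^+ sg * (eps / h) - q =
  (beta - k%:R / len i j) / f + (-1) ^+ sg * (eps / h) by ring.
apply: (le_trans (ler_normD _ _)).
have -> : K * v / h = f^-1 * v / h + eps * v / h by rewrite /K; ring.
apply: lerD.
  rewrite normrM [`|f^-1|]gtr0_norm ?invr_gt0// -mulrA mulrC ler_pM2l ?invr_gt0//.
  have -> : beta - k%:R / len i j = - (k%:R - len i j * beta) / len i j.
    by field; rewrite gt_eqF.
  rewrite normrM normrN [`|_^-1|]gtr0_norm ?invr_gt0// ler_pdivrMr//.
  by apply: (le_trans hk); rewrite -hE expr2 mulrA divfK// gt_eqF.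
rewrite normrMsign gtr0_norm ?divr_gt0// ler_pM2r ?invr_gt0//.
by rewrite ler_peMr// ltW.
Qed.

(** The success probability is at most [M * K * v / h], so with parameter [c / v] both terms of the
    exponent are of order [h / v]. The length condition gives [h >= v ^+ 3], hence
    [h / v >= v ^+ 2]. *)
Lemma prob_increment_event k sg :
  (P (increment_event v i j k sg) <= (2 * expR (- (rate * v ^+ 2)))%:E)%E.
Proof.
rewrite /increment_event; case: ifP => hk; last first.
  by rewrite measure0 lee_fin mulr_ge0// expR_ge0.
have y01 : 0 <= c / v <= 2^-1.
  rewrite divr_ge0//= ler_pdivrMr//.
  by apply: (@le_trans _ _ 2^-1); [rewrite ge_min lexx|rewrite ler_peMr].
set x := grid_point i j k sg.
have := count_increment_tail _ _ _ _ _ _ indepX cdfX (index_iota i j.+1) x q _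
  (f * eps * h / 2) (iota_uniq _ _) y01.
rewrite (size_window _ _ (ltnW ij)) => /le_trans; apply.
rewrite lee_fin ler_pM2l// ler_expR.
have Fxq : `|F x - F q| <= M * (K * v / h).
  have nd := cdf_nd _ _ _ _ _ _ cdfX.
  apply: (@le_trans _ _ (M * `|x - q|)); last first.
    by rewrite ler_pM2l//; exact: grid_dist.
  have incr := increment_le _ _ _ dF F_bound.
  have [qx|/ltW xq] := leP q x.
    by rewrite !ger0_norm ?subr_ge0 ?incr ?nd.
  by rewrite distrC [`|x - q|]distrC !ger0_norm ?subr_ge0 ?incr ?nd.
have h1 : 2 * len i j * `|F x - F q| * (c / v) ^+ 2 <=
    (c * h / v) * (2 * (M * K) * c).
  have -> : (c * h / v) * (2 * (M * K) * c) =
    2 * len i j * (M * (K * v / h)) * (c / v) ^+ 2.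
    by rewrite -hE; field; rewrite !gt_eqF.
  by rewrite ler_wpM2r ?sqr_ge0// ler_wpM2l// mulr_ge0.
have h2 : (c * h / v) * (2 * (M * K) * c) <= (c * h / v) * (f * eps / 4).
  rewrite ler_wpM2l ?divr_ge0 ?mulr_ge0//.
  have : c <= f * eps / (8 * (M * K)) by rewrite ge_min lexx orbT.
  rewrite ler_pdivlMr ?mulr_gt0//; lra.
have h3 : rate * v ^+ 2 <= (c * h / v) * (f * eps / 4).
  apply: (@le_trans _ _ (c * (f * eps) / 4 * v ^+ 2)).
    by rewrite ler_wpM2r ?sqr_ge0// ge_min lexx orbT.
  have -> : c * h / v * (f * eps / 4) = c * (f * eps) / 4 * (h / v) by ring.
  rewrite ler_wpM2l ?divr_ge0 ?mulr_ge0 ?(ltW f0) ?(ltW eps0)//.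
  by rewrite ler_pdivlMr// -exprSr sqrt_len_ge.
have -> : c / v * (f * eps * h / 2) = (c * h / v) * (f * eps / 4) * 2.
  by field; rewrite gt_eqF.
lra.
Qed.

End Bounds.

(** Union bound: exceedances over [t], then windows over [i] and [j], each costing one centre event
    and two increment events for every [k]. *)
Lemma prob_bad_event n v (b N : R) : 1 <= v ->
  b = 2 * expR (- (rate * v ^+ 2)) -> N = n.+1%:R ->
  (P (bad_event n v) <=
   (N * (2 * (C * (v ^+ 10 / 2) `^ (- lambda))) + N * (N * (b + N * (b + b))))%:E)%E.
Proof.
move=> v1 bE ->.
have b0 : 0 <= b by rewrite bE mulr_ge0// expR_ge0.
have v0 : 0 < v ^+ 10 by rewrite exprn_gt0// (lt_le_trans _ v1).
apply: le_trans (measureU2 _ _ _) _.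
- by apply: bigcup_measurable => t _; exact: measurable_abs_gt.
- by apply: bigcup_measurable => i _; apply: bigcup_measurable => j _.
rewrite EFinD; apply: leeD.
  apply: prob_bigcup_le => t; first exact: measurable_abs_gt.
  exact: prob_abs_gt.
apply: prob_bigcup_le => [i|i]; first by apply: bigcup_measurable => j _.
apply: prob_bigcup_le => // j.
rewrite /window_event; case: ifP => [/andP[ij long]|_]; last first.
  by rewrite measure0 lee_fin addr_ge0// mulr_ge0// addr_ge0.
apply: le_trans (measureU2 _ _ _) _ => //.
  by apply: bigcup_measurable => k _; exact: measurableU.
rewrite EFinD; apply: leeD; first by rewrite bE; exact: prob_centre_event.
apply: prob_bigcup_le => k; first exact: measurableU.
apply: le_trans (measureU2 _ _ _) _ => //.
by rewrite EFinD bE; apply: leeD; exact: prob_increment_event.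
Qed.

(** Deterministic. Long windows use the linearization, with [large] absorbing the Taylor remainder.
    A short window has length below [v ^+ 6] and deviation at most [(1 + |q| + f^-1) * v ^+ 10];
    [small] bounds the product by [eps * v ^+ 18]. *)
Lemma good_event n v w : 1 <= v -> v ^+ 36 = n%:R ->
  1 + `|q| + f^-1 <= eps * v ^+ 2 -> 2 * M * K ^+ 2 <= f * eps * v ->
  ~ bad_event n v w ->
  forall i j, (1 <= i)%N -> (i < j)%N -> (j <= n)%N ->
  len i j * `|empq (fun t => X t) beta i j w - q
     - (beta - empF (fun t => X t) i j w q) / f| <= eps * Num.sqrt n%:R.
Proof.
move=> v1 vn small large good i j i1 ij jn.
have v0 : 0 < v := lt_le_trans ltr01 v1.
have sqrtn : Num.sqrt n%:R = v ^+ 18.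
  by rewrite -vn (exprM v 18 2) sqrtr_sqr ger0_norm// exprn_ge0// ltW.
have m0 : 0 < len i j by rewrite ltr0n addn1.
(* Indices start at 1, so a window has at most [n] elements and its count is among the values
   [k <= n] of the union. *)
have mn : len i j <= n%:R.
  by rewrite ler_nat addn1 (leq_trans _ jn)// ltn_subrL i1 (leq_trans _ ij).
have [long|short] := leP (v ^+ 6) (len i j).
  have good_ij : ~ (centre_event v i j `|`
    \bigcup_(k in `I_n.+1)
      (increment_event v i j k false `|` increment_event v i j k true)) w.
    move=> h; apply: good; right; exists i; first exact: leq_trans (ltnW ij) jn.
    by exists j => //; rewrite /window_event ij long.
  have [k kn hk] := count_le_nat (fun t => X t) (index_iota i j.+1) w q.
  rewrite (size_window _ _ (ltnW ij)) in kn.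
  have centre : `|k%:R - len i j * beta| < v * Num.sqrt (len i j).
    by rewrite ltNge; apply/negP => h; apply: good_ij; left; rewrite /centre_event /= hk.
  have incr sg : `|count (index_iota i j.+1) w (grid_point i j k sg) - k%:R
      - len i j * (F (grid_point i j k sg) - F q)| < f * eps * Num.sqrt (len i j) / 2.
    rewrite ltNge; apply/negP => h; apply: good_ij; right; exists k.
      by move: mn; rewrite ler_nat => /(leq_trans kn).
    have : increment_event v i j k sg w by rewrite /increment_event (ltW centre) /= hk.
    by case: (sg); [right|left].
  have [lo [hi [Hlo Hhi]]] := empF_bracket (fun t => X t) i j w beta (ltnW ij) beta01.
  rewrite !(empF_count _ _ _ _ _ (ltnW ij)) in Hlo Hhi *.
  rewrite /empq (_ : empF _ i j w =
      fun z => (len i j)^-1 * count (index_iota i j.+1) w z);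
    last by apply/funext => z; rewrite empF_count// ltnW.
  apply: (@le_trans _ _ (eps * Num.sqrt (len i j))); last first.
    by rewrite ler_pM2l// ler_wsqrtr.
  apply: (quantile_linearization R _ F _ q f M beta v eps lo hi) => //.
  - exact: ltW.
  - by apply: taylor2 => //; exact: cdf_nd cdfX.
  - exact: count_le_nd.
  - by rewrite hk ltW.
  - rewrite hk => x [->|->].
      by have := incr false; rewrite /grid_point expr0 mul1r.
    by have := incr true; rewrite /grid_point expr1 mulN1r.
  - have h3 := sqrt_len_ge v i j v1 long.
    have : f * eps * v ^+ 3 <= f * eps * Num.sqrt (len i j).
      by rewrite ler_wpM2l// mulr_ge0 ?ltW.
    have : 2 * M * K ^+ 2 * v ^+ 2 <= f * eps * v * v ^+ 2.
      by rewrite ler_wpM2r ?sqr_ge0.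
    rewrite -/K; lra.
have XA t : (i <= t <= j)%N -> `|X t w| <= v ^+ 10.
  move=> /andP[_ tj]; rewrite leNgt; apply/negP => h; apply: good; left.
  by exists t => //=; rewrite ltnS (leq_trans tj).
have qA := empq_bound (fun t => X t) i j w beta _ (ltnW ij) beta01 XA.
have v10 : 1 <= v ^+ 10 by rewrite exprn_ege1.
have dev : `|empq (fun t => X t) beta i j w - q
     - (beta - empF (fun t => X t) i j w q) / f| <= (1 + `|q| + f^-1) * v ^+ 10.
  apply: (le_trans (ler_normB _ _)).
  have h1 := ler_normB (empq (fun t => X t) beta i j w) q.
  have h2 : `|(beta - empF (fun t => X t) i j w q) / f| <= f^-1.
    rewrite normrM [`|f^-1|]gtr0_norm ?invr_gt0//.
    rewrite ler_piMl ?invr_ge0 ?(ltW f0)//.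
    have /andP[e0 e1] := empF_ge0_le1 (fun t => X t) i j w q (ltnW ij).
    case/andP: beta01 => b0 b1; rewrite ler_norml; apply/andP; split; lra.
  have qv : `|q| <= `|q| * v ^+ 10 by rewrite ler_peMr.
  have fv : f^-1 <= f^-1 * v ^+ 10 by rewrite ler_peMr// invr_ge0 ltW.
  lra.
rewrite sqrtn.
apply: (@le_trans _ _ (v ^+ 6 * ((1 + `|q| + f^-1) * v ^+ 10))).
  by apply: ler_pM => //; exact: ltW.
have -> : eps * v ^+ 18 = v ^+ 6 * ((eps * v ^+ 2) * v ^+ 10) by ring.
rewrite ler_pM2l ?exprn_gt0// ler_pM2r//.
exact: lt_le_trans v10.
Qed.

End BadEvent.

(** * Rates of decay and passage to the limit *)

(** Raise [x / k.+1 <= expR (x / k.+1)] to the power [k.+1] and invert. *)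
Lemma expRN_le_pow (R : realType) (k : nat) (x : R) :
  0 < x -> expR (- x) <= (k.+1%:R / x) ^+ k.+1.
Proof.
move=> x0; have k0 : 0 < k.+1%:R :> R by [].
have -> : - x = - (x / k.+1%:R) * k.+1%:R by field; rewrite gt_eqF.
rewrite expRM_natr lerXn2r ?nnegrE ?expR_ge0 ?divr_ge0 ?(ltW x0)//.
rewrite expRN -[leRHS]invf_div lef_pV2 ?posrE ?expR_gt0 ?divr_gt0//.
by apply: le_trans (expR_ge1Dx _); rewrite lerDr.
Qed.

Lemma bigmax_nat_le (R : realType) (m n : nat) (h : nat -> R) (x : R) :
  0 <= x -> (forall i, (m <= i < n)%N -> h i <= x) ->
  \big[Order.max/0]_(m <= i < n) h i <= x.
Proof. by move=> x0 hx; rewrite big_nat bigmax_le. Qed.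

Lemma measurable_statistic d (T : measurableType d) (R : realType)
    (X : nat -> T -> R) (beta q f : R) (n : nat) :
  (forall t, measurable_fun setT (X t)) -> 0 < beta < 1 ->
  measurable_fun setT (fun w => \big[Order.max/0]_(1 <= i < n.+1)
    \big[Order.max/0]_(i.+1 <= j < n.+1)
      ((j - i + 1)%:R *
       `| empq X beta i j w - q - (beta - empF X i j w q) / f |)).
Proof.
move=> mX b01; apply: measurable_bigmax => i _; apply: measurable_bigmax => j.
rewrite mem_index_iota => /andP[/ltnW ij _].
apply: measurable_funM => //; apply: measurableT_comp => //.
apply: measurable_funB.
  by apply: measurable_funB => //; exact: measurable_empq.
apply: measurable_funM => //; apply: measurable_funB => //.
exact: measurable_empF.
Qed.

(** Since [v ^+ 10] is [n] to the power 5/18, the sample exceedances contribute order [n] to the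
    power [1 - 5 * lambda / 18]. *)
Lemma bad_event_rate (R : realType) (C lambda rate : R) :
  0 < C -> 0 < rate ->
  exists A B : R, forall (n : nat) (v b N : R), (0 < n)%N ->
  v = n%:R `^ 36^-1 -> b = 2 * expR (- (rate * v ^+ 2)) -> N = n.+1%:R ->
  (N * (2 * (C * (v ^+ 10 / 2) `^ (- lambda))) + N * (N * (b + N * (b + b)))
   <= A * n%:R `^ (- (5 * lambda / 18 - 1)) + B * n%:R `^ (-1))%R.
Proof.
move=> C0 r0.
(* Exponent 72 puts [v ^+ 144 = n ^+ 4] in the denominator, which beats the factor of order [n ^+ 3]
   from the union bound and leaves [1 / n]. *)
pose D : R := (72%:R / rate) ^+ 72.
exists (4 * C * 2^-1 `^ (- lambda)), (48 * D) => n v b N n0 vE b_def N_def.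
have nn0 : 0 < n%:R :> R by rewrite ltr0n.
have v0 : 0 < v by rewrite vE powR_gt0.
have vn : v ^+ 36 = n%:R.
  by rewrite -powR_mulrn ?(ltW v0)// vE -powRrM mulVf// powRr1// ltW.
have N1 : 1 <= N by rewrite N_def ler1n.
have N2 : N <= 2 * n%:R.
  by rewrite N_def -natr1 mulr_natl mulr2n lerD2l ler1n.
have D0 : 0 <= D by rewrite exprn_ge0// divr_ge0// ltW.
have bE : b <= 2 * D / n%:R ^+ 4.
  rewrite b_def -mulrA ler_pM2l//.
  apply: (le_trans (expRN_le_pow _ 71 _ _)); first by rewrite mulr_gt0// exprn_gt0.
  rewrite invfM mulrA exprMn exprVn -/D -vn -!exprM.
  exact: lexx.
have b0 : 0 <= b by rewrite b_def mulr_ge0// expR_ge0.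
apply: lerD.
  have -> : (v ^+ 10 / 2) `^ (- lambda) =
      2^-1 `^ (- lambda) * (n%:R `^ (- (5 * lambda / 18 - 1)) / n%:R).
    rewrite powRM ?exprn_ge0 ?(ltW v0)// mulrC; congr (_ * _).
    rewrite -powR_mulrn ?(ltW v0)// vE -!powRrM -(powR_inv1 (ltW nn0)).
    rewrite -powRD; last by apply/implyP => _; rewrite gt_eqF.
    by congr (_ `^ _); field.
  set g := _ `^ (- (_ - 1)).
  have g0 : 0 <= g by exact: powR_ge0.
  set a := 2^-1 `^ _; have a0 : 0 <= a by exact: powR_ge0.
  apply: (@le_trans _ _ ((2 * n%:R) * (2 * (C * (a * (g / n%:R)))))).
    by rewrite ler_wpM2r// !mulr_ge0// ?invr_ge0 ltW.
  by rewrite le_eqVlt; apply/orP; left; apply/eqP; field; rewrite gt_eqF.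
rewrite powR_inv1 ?(ltW nn0)//.
apply: (@le_trans _ _ (3 * N ^+ 3 * b)).
  have h1 : N ^+ 2 * b <= N ^+ 3 * b.
    by rewrite ler_wpM2r// ler_weXn2l.
  have -> : N * (N * (b + N * (b + b))) = N ^+ 2 * b + 2 * (N ^+ 3 * b) by ring.
  lra.
apply: (@le_trans _ _ (3 * (2 * n%:R) ^+ 3 * (2 * D / n%:R ^+ 4))).
  apply: ler_pM => //; first by rewrite mulr_ge0// exprn_ge0// (le_trans _ N1).
  by rewrite ler_pM2l// lerXn2r// nnegrE// ?mulr_ge0// (le_trans _ N1).
by rewrite le_eqVlt; apply/orP; left; apply/eqP; field; rewrite gt_eqF.
Qed.

Theorem theorem4p4 (d : measure_display) (T : measurableType d) (R : realType)
  (P : probability T R) (X : nat -> {RV P >-> R}) (F : R -> R)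
  (C lambda beta : R) :
  mutually_independent X ->
  (forall t x, P [set w | X t w <= x] = (F x)%:E) ->
  (forall x, derivable F x 1) ->
  (forall x, derivable (derive1 F) x 1) ->
  (exists M : R, forall x, derive1 F x + `|derive1 (derive1 F) x| <= M) ->
  0 < C -> 18 / 5 < lambda ->
  (forall x : R, 0 < x -> (P [set w | (x < `|X 1%N w|)%R] <= (C * x `^ (- lambda))%:E)%E) ->
  0 < beta < 1 ->
  0 < derive1 F (geninv F beta) ->
  forall eps : R, 0 < eps ->
    (P [set w | eps <
        (Num.sqrt n%:R)^-1 *
        \big[Order.max/0]_(1 <= i < n.+1) \big[Order.max/0]_(i.+1 <= j < n.+1)
          ((j - i + 1)%:R *
           `| empq (fun t => X t) beta i j w - geninv F beta
              - (beta - empF (fun t => X t) i j w (geninv F beta)) / derive1 F (geninv F beta) |)])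
    @[n --> \oo] --> 0%E.
Proof.
move=> indepX cdfX dF ddF [M F_bound] C0 lambda_gt tailX beta01 f0 eps eps0.
have lambda0 : 0 < lambda by apply: lt_trans lambda_gt; rewrite divr_gt0.
set q := geninv F beta in f0 *; set f := derive1 F q in f0 *.
have rate0 := rate_gt0 R F beta M eps F_bound f0 eps0.
set rate := Order.min _ _ in rate0.
have [A [B hAB]] := bad_event_rate R C lambda rate C0 rate0.
pose v n : R := n%:R `^ 36^-1.
pose g n : R := A * n%:R `^ (- (5 * lambda / 18 - 1)) + B * n%:R `^ (-1).
have g_cvg : (g n)%:E @[n --> \oo] --> 0%E.
  apply: cvg_EFin; first exact: nearW.
  rewrite [X in _ --> X](_ : 0 = A * 0 + B * 0); last by rewrite !mulr0 addr0.
  apply: cvgD; apply: cvgMr; apply: powRN_cvg0 => //.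
  (* Positivity of [5 * lambda / 18 - 1] is exactly [lambda > 18 / 5]. *)
  by rewrite subr_gt0 ltr_pdivlMr//; lra.
(* Once [n >= V ^+ 36], one has [v n >= V], which gives the three size conditions of
   [good_event]. *)
pose V := Order.max 1 (Order.max ((1 + `|q| + f^-1) / eps)
  (2 * M * (f^-1 + eps) ^+ 2 / (f * eps))).
have V1 : 1 <= V by rewrite le_max lexx.
apply: (squeeze_cvge _ (cvg_cst 0%E) g_cvg).
have /archi_boundP : 0 <= V ^+ 36 by rewrite exprn_ge0// (le_trans ler01).
set N0 := Num.bound _ => /ltW hN0.
exists N0.+1 => // n /= Nn.
have n0 : (0 < n)%N by exact: leq_ltn_trans Nn.
have vn : v n ^+ 36 = n%:R.
  by rewrite -powR_mulrn ?powR_ge0// -powRrM mulVf// powRr1.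
have Vv : V <= v n.
  rewrite -(@ler_pXn2r _ 36) ?nnegrE ?powR_ge0//; last exact: le_trans V1.
  by rewrite vn (le_trans hN0)// ler_nat ltnW.
have v1 : 1 <= v n := le_trans V1 Vv.
rewrite measure_ge0 /=.
apply: (@le_trans _ _ (P (bad_event d T R P X F beta eps n (v n)))); last first.
  apply: le_trans (prob_bad_event d T R P X F C lambda beta M eps indepX cdfX dF
    F_bound C0 lambda0 tailX beta01 f0 eps0 n (v n) _ _ v1 erefl erefl) _.
  by rewrite lee_fin; exact: (hAB n (v n) _ _ n0).
apply: measure_subset.
- rewrite (_ : mkset _ = ~` [set w | (Num.sqrt n%:R)^-1 *
    \big[Order.max/0]_(1 <= i < n.+1) \big[Order.max/0]_(i.+1 <= j < n.+1)
      ((j - i + 1)%:R *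
       `| empq (fun t => X t) beta i j w - q
          - (beta - empF (fun t => X t) i j w q) / f |) <= eps]); last first.
    apply/seteqP; split=> w /=; first by rewrite ltNge => /negP.
    by move=> /negP; rewrite -ltNge.
  apply: measurableC; rewrite -[X in measurable X]setTI.
  apply: measurable_fun_le => //; apply: measurable_funM => //.
  exact: measurable_statistic.
- exact: measurable_bad_event.
move=> w /=; apply: contraPP => good; apply/negP; rewrite -leNgt.
have sq0 : 0 < Num.sqrt n%:R :> R by rewrite sqrtr_gt0 ltr0n.
rewrite mulrC ler_pdivrMr//.
(* The iterated maxima start from 0, so their bound has to be nonnegative. *)
have es : 0 <= eps * Num.sqrt n%:R by rewrite mulr_ge0// ltW.
apply: bigmax_nat_le => // i /andP[i1 _].
apply: bigmax_nat_le => // j /andP[ij jn].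
apply: (good_event d T R P X F C lambda beta M eps cdfX dF ddF F_bound C0 lambda0
  tailX beta01 f0 eps0 n (v n) w v1 vn _ _ good) => //.
- have : (1 + `|q| + f^-1) / eps <= v n.
    by apply: le_trans Vv; rewrite !le_max lexx orbT.
  rewrite ler_pdivrMr// mulrC => /le_trans; apply.
  by rewrite ler_pM2l// expr2 ler_peMr// (le_trans ler01).
- have : 2 * M * (f^-1 + eps) ^+ 2 / (f * eps) <= v n.
    by apply: le_trans Vv; rewrite !le_max lexx !orbT.
  by rewrite ler_pdivrMr ?mulr_gt0// [v n * _]mulrC.
Qed.
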